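(* There is a canonical equivalence of categories $\Gamma\simeq\Box_{\mathrm{lin}}$.
   Context: $\Gamma$ (Segal's category) is the opposite of $\mathrm{Fin}_*$, where $\mathrm{Fin}_*$ has objects the finite pointed sets $\langle n\rangle=\{*\}\sqcup\{1,\dots,n\}$, $n\in\mathbb N_0$, and morphisms the base-point preserving maps. The cube category $\Box$ has as objects the sets $\{0,1\}^n$, $n\in\mathbb N_0$, and as morphisms $\{0,1\}^n\to\{0,1\}^m$ the maps of sets which are restrictions of affine linear maps $\mathbb Z^n\to\mathbb Z^m$. $\Box_{\mathrm{lin}}$ is the wide subcategory of $\Box$ consisting of those maps which are restrictions of linear maps $\mathbb Z^n\to\mathbb Z^m$. *)

(* Defs.v *)
From HB Require Import structures.
From mathcomp Require Import all_boot all_order all_algebra.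
From mathcomp Require Import boolp.

Set Implicit Arguments.
Unset Strict Implicit.
Unset Printing Implicit Defensive.

Import GRing.Theory.
Local Open Scope ring_scope.

(* [compm g f] is "g after f". *)
Record category := Category {
  obj :> Type;
  mor : obj -> obj -> Type;
  idm : forall a, mor a a;
  compm : forall a b c, mor b c -> mor a b -> mor a c;
  comp_idl : forall a b (f : mor a b), compm (idm b) f = f;
  comp_idr : forall a b (f : mor a b), compm f (idm a) = f;
  compA : forall a b c d (h : mor c d) (g : mor b c) (f : mor a b),
    compm h (compm g f) = compm (compm h g) f }.

Arguments mor C a b : rename, clear implicits.
Arguments idm {C} a : rename.
Arguments compm {C a b c} g f : rename.

Definition opposite (C : category) : category :=
  @Category C (fun a b => mor C b a) (fun a => idm a)
    (fun a b c g f => compm f g)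
    (fun a b f => comp_idr f) (fun a b f => comp_idl f)
    (fun a b c d h g f => esym (compA f g h)).

Record is_functor (C D : category) (F0 : C -> D)
    (F1 : forall a b : C, mor C a b -> mor D (F0 a) (F0 b)) : Prop := IsFunctor {
  functor_id : forall a, F1 a a (idm a) = idm (F0 a);
  functor_comp : forall a b c (g : mor C b c) (f : mor C a b),
    F1 a c (compm g f) = compm (F1 b c g) (F1 a b f) }.

Record functor (C D : category) := Functor {
  fob :> C -> D;
  fhom : forall a b : C, mor C a b -> mor D (fob a) (fob b);
  functorP : is_functor fhom }.

Arguments fhom {C D} F {a b} f : rename.

Lemma id_is_functor (C : category) :
  @is_functor C C (fun a => a) (fun a b f => f).
Proof. by []. Qed.

Definition id_functor (C : category) : functor C C :=
  Functor (id_is_functor C).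

Lemma comp_is_functor (C D E : category) (G : functor D E) (F : functor C D) :
  @is_functor C E (fun a => G (F a)) (fun a b f => fhom G (fhom F f)).
Proof.
split=> [a|a b c g f].
  by rewrite (functor_id (functorP F)) (functor_id (functorP G)).
by rewrite (functor_comp (functorP F)) (functor_comp (functorP G)).
Qed.

Definition comp_functor (C D E : category) (G : functor D E)
    (F : functor C D) : functor C E :=
  Functor (comp_is_functor G F).

Definition is_iso (C : category) (a b : C) (f : mor C a b) : Prop :=
  exists g : mor C b a, compm g f = idm a /\ compm f g = idm b.

Definition nat_isomorphic (C D : category) (F G : functor C D) : Prop :=
  exists eta : forall a : C, mor D (F a) (G a),
    (forall a b (f : mor C a b),
       compm (eta b) (fhom F f) = compm (fhom G f) (eta a)) /\
    (forall a, is_iso (eta a)).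

Definition is_equivalence (C D : category) (F : functor C D) : Prop :=
  exists G : functor D C,
    nat_isomorphic (comp_functor G F) (id_functor C) /\
    nat_isomorphic (comp_functor F G) (id_functor D).

Record is_wide (C : category) (P : forall a b : C, mor C a b -> Prop) : Prop :=
  IsWide {
    wide_id : forall a, P a a (idm a);
    wide_comp : forall a b c (g : mor C b c) (f : mor C a b),
      P b c g -> P a b f -> P a c (compm g f) }.

Definition wide_mor (C : category) (P : forall a b : C, mor C a b -> Prop)
  (a b : C) : Type := {f : mor C a b | P a b f}.

Lemma wide_mor_inj (C : category) (P : forall a b : C, mor C a b -> Prop)
    (a b : C) (f g : wide_mor P a b) :
  sval f = sval g -> f = g.
Proof. by case: f g => [f Pf] [g Pg] /= fg; exact: eq_exist. Qed.

Definition wide_idm (C : category) (P : forall a b : C, mor C a b -> Prop)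
    (wP : is_wide P) (a : C) : wide_mor P a a :=
  exist _ (idm a) (wide_id wP a).

Definition wide_compm (C : category) (P : forall a b : C, mor C a b -> Prop)
    (wP : is_wide P) (a b c : C) (g : wide_mor P b c) (f : wide_mor P a b) :
    wide_mor P a c :=
  exist _ (compm (sval g) (sval f)) (wide_comp wP (svalP g) (svalP f)).

Definition wide_subcategory (C : category)
    (P : forall a b : C, mor C a b -> Prop) (wP : is_wide P) : category.
Proof.
apply: (@Category C (wide_mor P) (wide_idm wP) (wide_compm wP)).
- by move=> a b f; apply: wide_mor_inj; exact: comp_idl.
- by move=> a b f; apply: wide_mor_inj; exact: comp_idr.
- by move=> a b c d h g f; apply: wide_mor_inj; exact: compA.
Defined.

(* The category whose objects are the sets [X n], indexed by [n : nat], and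
   whose morphisms are all maps between them. *)
Definition maps_category (X : nat -> Type) : category :=
  @Category nat (fun m n => X m -> X n) (fun m x => x)
    (fun a b c g f x => g (f x))
    (fun a b f => erefl) (fun a b f => erefl) (fun a b c d h g f => erefl).

(* The pointed set <n>: the base point is [None], and [Some i] stands for
   the element i + 1 of {1, ..., n}. *)
Definition fin_ptd (n : nat) : Type := option 'I_n.

Definition base_preserving (m n : maps_category fin_ptd) (f : mor _ m n) : Prop :=
  f None = None.

Lemma base_preserving_wide : is_wide base_preserving.
Proof. by split=> // a b c g f gP fP; rewrite /base_preserving /= fP gP. Qed.

Definition FinPtd : category := wide_subcategory base_preserving_wide.

Definition Gamma : category := opposite FinPtd.

Definition cube (n : nat) : Type := 'rV[bool]_n.

(* The inclusion of {0,1}^n into Z^n. *)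
Definition cube_incl (n : nat) (x : cube n) : 'rV[int]_n :=
  map_mx (fun b : bool => Posz b) x.

Definition restricts_affine (m n : maps_category cube) (f : mor _ m n) : Prop :=
  exists (L : {linear 'rV[int]_m -> 'rV[int]_n}) (v : 'rV[int]_n),
    forall x : cube m, cube_incl (f x) = L (cube_incl x) + v.

Lemma restricts_affine_wide : is_wide restricts_affine.
Proof.
split=> [a|a b c g f [L [v gE]] [M [w fE]]].
  by exists idfun, 0 => x; rewrite addr0.
exists (L \o M), (L w + v) => x.
by rewrite /= gE fE linearD addrA.
Qed.

Definition Box : category := wide_subcategory restricts_affine_wide.

Definition restricts_linear (m n : Box) (f : mor Box m n) : Prop :=
  exists L : {linear 'rV[int]_m -> 'rV[int]_n},
    forall x : cube m, cube_incl (sval f x) = L (cube_incl x).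

Lemma restricts_linear_wide : is_wide restricts_linear.
Proof.
split=> [a|a b c g f [L gE] [M fE]]; first by exists idfun.
by exists (L \o M) => x; rewrite /= gE fE.
Qed.

Definition BoxLin : category := wide_subcategory restricts_linear_wide.

(* A morphism from m to n in Gamma is a pointed map <n> -> <m>. *)
Definition Gamma_map (m n : nat) (f : mor Gamma m n) :
  fin_ptd n -> fin_ptd m := sval f.

Definition BoxLin_map (m n : nat) (f : mor BoxLin m n) : cube m -> cube n :=
  sval (sval f).

(* Precomposition with f : <n> -> <m>, where {0,1}^m is identified with the
   set of pointed maps from <m> to {0,1} based at 0. *)
Definition pullback (m n : nat) (f : fin_ptd n -> fin_ptd m) (x : cube m) :
    cube n :=
  \row_(i < n) (if f (Some i) is Some j then x ord0 j else false).

(* Main.v *)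
Require Import Defs.
From mathcomp Require Import all_boot.
From mathcomp Require Import all_algebra boolp.

(** The functor sends a pointed map f : <n> -> <m> to precomposition with f.
    In coordinates, the i-th coordinate of the output is either 0 or a single
    coordinate of the input, so it is the restriction of a linear map
    ([pullback_linear]).

    Conversely let g : {0,1}^m -> {0,1}^n be the restriction of a linear map L,
    and fix an output coordinate i. The coefficients L(e_j)_i are values of g,
    hence 0 or 1. If two of them were 1, then e_j + e_k, which is again a vertex
    of the cube, would be mapped to a vertex with i-th coordinate 2; so at most
    one of them is 1 ([linear_cube_map_inj]). Therefore g is precomposition with
    the pointed map sending i to the j with L(e_j)_i = 1, or to the base point
    if there is none ([pullback_ptd_of_cube]). As the values on the vertices e_j
    recover the pointed map ([ptd_of_cube_pullback]), the functor is bijective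
    on morphisms; it is the identity on objects, hence an equivalence. *)

Set Implicit Arguments.
Unset Strict Implicit.
Unset Printing Implicit Defensive.

Import GRing.Theory.
Local Open Scope ring_scope.

(** The quasi-inverse sends d to a chosen a with an isomorphism e : F a -> d,
    and a morphism to the unique preimage of its conjugate by these
    isomorphisms. The isomorphisms e form the counit, and the preimages under F of
    the e : F (G (F a)) -> F a form the inverse of the unit. *)
Lemma fully_faithful_eso_equivalence (C D : category) (F : functor C D) :
  (forall a b : C, bijective (@fhom C D F a b)) ->
  (forall d : D, exists (a : C) (e : mor D (F a) d), is_iso e) ->
  is_equivalence F.
Proof.
move=> ff eso.
have ffP a b : {g | cancel (@fhom C D F a b) g /\ cancel g (@fhom C D F a b)}.
  by apply: cid; case: (ff a b) => g; exists g.
pose lift a b : mor D (F a) (F b) -> mor C a b := sval (ffP a b).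
have Fl a b h : fhom F (@lift a b h) = h.
  exact: (svalP (ffP a b)).2.
have F_inj a b (f g : mor C a b) : fhom F f = fhom F g -> f = g.
  exact: (bij_inj (ff a b)).
have F_comp a b c (g : mor C b c) (f : mor C a b) :
    fhom F (compm g f) = compm (fhom F g) (fhom F f).
  exact: functor_comp (functorP F) _ _ _ g f.
have F_id a : fhom F (idm a) = idm (F a) by exact: functor_id (functorP F) a.
pose s d := sval (cid (eso d)).
pose eP d := cid (svalP (cid (eso d))).
pose e d : mor D (F (s d)) d := sval (eP d).
pose vP d := cid (svalP (eP d)).
pose v d : mor D d (F (s d)) := sval (vP d).
have ve d : compm (v d) (e d) = idm _ by exact: (svalP (vP d)).1.
have ev d : compm (e d) (v d) = idm _ by exact: (svalP (vP d)).2.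
clearbody e v.
pose G1 (d d' : D) (h : mor D d d') : mor C (s d) (s d') :=
  lift _ _ (compm (v d') (compm h (e d))).
have GP : is_functor G1.
  split=> [d|d1 d2 d3 h k]; apply: F_inj.
    by rewrite Fl F_id comp_idl ve.
  rewrite F_comp !Fl -!Defs.compA; congr (compm _ (compm _ _)).
  by rewrite [RHS]Defs.compA ev comp_idl.
exists (Functor GP); split.
- exists (fun a => lift _ _ (e (F a))); split=> [a b f|a].
    apply: F_inj; rewrite /= !F_comp !Fl Defs.compA ev comp_idl //.
  exists (lift _ _ (v (F a))).
  by split; apply: F_inj; rewrite F_comp !Fl F_id ?ve ?ev.
- exists e; split=> [a b f|a]; last by exists (v a); split; [exact: ve | exact: ev].
  by rewrite /= Fl Defs.compA ev comp_idl.
Qed.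

Definition basis_vertex (m : nat) (j : 'I_m) : cube m := \row_k (k == j).

Definition pullback_mx (m n : nat) (f : fin_ptd n -> fin_ptd m) :
    'M[int]_(m, n) :=
  \matrix_(j, i) (f (Some i) == Some j)%:R.

Lemma pullback_linear (m n : nat) (f : fin_ptd n -> fin_ptd m) (x : cube m) :
  cube_incl (pullback f x) = mulmxr (pullback_mx f) (cube_incl x).
Proof.
apply/rowP => i; rewrite /= !mxE.
case fi: (f (Some i)) => [j|].
  rewrite (bigD1 j) //= !mxE fi eqxx mulr1 big1 ?addr0 // => k kj.
  by rewrite !mxE fi (inj_eq Some_inj) eq_sym (negbTE kj) mulr0.
by rewrite big1 // => k _; rewrite !mxE fi mulr0.
Qed.

Lemma pullback_basis_vertex (m n : nat) (f : fin_ptd n -> fin_ptd m) i j :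
  pullback f (basis_vertex j) ord0 i = (f (Some i) == Some j).
Proof. by rewrite !mxE; case: (f _) => [k|//]; rewrite mxE. Qed.

Lemma pullback_id (n : nat) (x : cube n) : pullback id x = x.
Proof. by apply/rowP => i; rewrite mxE. Qed.

Lemma pullback_comp (m n p : nat) (f : fin_ptd n -> fin_ptd m)
    (g : fin_ptd p -> fin_ptd n) (x : cube m) :
  f None = None -> pullback (f \o g) x = pullback g (pullback f x).
Proof.
move=> f0; apply/rowP => i; rewrite !mxE /=.
by case: (g _) => [j|]; rewrite ?mxE ?f0.
Qed.

Lemma cube_incl_basis (m : nat) (j : 'I_m) :
  cube_incl (basis_vertex j) = delta_mx ord0 j.
Proof. by apply/rowP => k; rewrite !mxE; case: (k == j). Qed.

(** The matrix of L can be read off from g, since its rows L(e_j) are the images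
    under g of vertices of the cube. In particular its entries are 0 or 1. *)
Lemma linear_cube_mapE (m n : nat) (g : cube m -> cube n)
    (L : {linear 'rV[int]_m -> 'rV[int]_n}) (x : cube m) (i : 'I_n) :
  (forall y, cube_incl (g y) = L (cube_incl y)) ->
  (g x ord0 i : int) =
    \sum_j (x ord0 j : int) * (g (basis_vertex j) ord0 i : int).
Proof.
move=> gL; have := congr1 (fun M : 'rV[int]_n => M ord0 i) (gL x).
rewrite [cube_incl x]row_sum_delta linear_sum summxE mxE => ->.
apply: eq_bigr => j _.
by rewrite linearZ -cube_incl_basis -gL !mxE.
Qed.

(** Otherwise the vertex e_j + e_k would be sent to a vector with a coordinate
    at least 2. *)
Lemma linear_cube_map_inj (m n : nat) (g : cube m -> cube n)
    (L : {linear 'rV[int]_m -> 'rV[int]_n}) (i : 'I_n) (j k : 'I_m) :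
  (forall y, cube_incl (g y) = L (cube_incl y)) ->
  g (basis_vertex j) ord0 i -> g (basis_vertex k) ord0 i -> j = k.
Proof.
move=> gL gj gk; apply/eqP; apply: contraT => jk.
have := linear_cube_mapE (\row_l ((l == j) || (l == k))) i gL.
rewrite (bigD1 j) //= (bigD1 k) 1?eq_sym //= big1; last first.
  by move=> l /andP[lj lk]; rewrite mxE (negbTE lj) (negbTE lk) mul0r.
by rewrite !mxE !eqxx orbT gj gk; case: (g _ _ _).
Qed.

(** The choice of j is unambiguous when g is the restriction of a linear map, by
    [linear_cube_map_inj]. *)
Definition ptd_of_cube (m n : nat) (g : cube m -> cube n) (u : fin_ptd n) :
    fin_ptd m :=
  if u is Some i then [pick j | g (basis_vertex j) ord0 i] else None.

Lemma ptd_of_cube_pullback (m n : nat) (f : fin_ptd n -> fin_ptd m) :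
  f None = None -> ptd_of_cube (pullback f) =1 f.
Proof.
move=> f0 [i|] //=; case: pickP => [j|noj].
  by rewrite pullback_basis_vertex => /eqP.
by case fi: (f _) => [j|] //; have := noj j; rewrite pullback_basis_vertex fi eqxx.
Qed.

Lemma pullback_ptd_of_cube (m n : nat) (g : cube m -> cube n)
    (L : {linear 'rV[int]_m -> 'rV[int]_n}) :
  (forall y, cube_incl (g y) = L (cube_incl y)) ->
  pullback (ptd_of_cube g) =1 g.
Proof.
move=> gL x; apply/rowP => i; rewrite mxE /=.
have := linear_cube_mapE x i gL.
case: pickP => [j gj|noj].
  rewrite (bigD1 j) //= gj mulr1 big1 ?addr0.
    by case: (x ord0 j); case: (g x ord0 i).
  move=> k kj; case gk: (g (basis_vertex k) ord0 i); last by rewrite mulr0.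
  by rewrite (linear_cube_map_inj gL gj gk) eqxx in kj.
rewrite big1; first by case: (g x ord0 i).
by move=> k _; rewrite noj mulr0.
Qed.

Lemma BoxLin_map_inj (m n : nat) (g h : mor BoxLin m n) :
  BoxLin_map g =1 BoxLin_map h -> g = h.
Proof. by move=> gh; do 2 apply: wide_mor_inj; apply: funext. Qed.

Lemma Gamma_map_inj (m n : nat) (f h : mor Gamma m n) :
  Gamma_map f =1 Gamma_map h -> f = h.
Proof. by move=> fh; apply: wide_mor_inj; apply: funext. Qed.

Lemma pullback_restricts_affine (m n : nat) (f : fin_ptd n -> fin_ptd m) :
  restricts_affine (pullback f : mor (maps_category cube) m n).
Proof.
by exists (mulmxr (pullback_mx f)), 0 => x; rewrite addr0 pullback_linear.
Qed.

Definition pullback_Box (m n : nat) (f : fin_ptd n -> fin_ptd m) :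
    mor Box m n :=
  exist _ (pullback f) (pullback_restricts_affine f).

Lemma pullback_restricts_linear (m n : nat) (f : fin_ptd n -> fin_ptd m) :
  restricts_linear (pullback_Box f).
Proof. by exists (mulmxr (pullback_mx f)) => x; rewrite pullback_linear. Qed.

Definition pullback_BoxLin (m n : nat) (f : mor Gamma m n) : mor BoxLin m n :=
  exist _ (pullback_Box (Gamma_map f)) (pullback_restricts_linear (Gamma_map f)).

Lemma pullback_is_functor :
  @is_functor Gamma BoxLin (fun n : nat => n) pullback_BoxLin.
Proof.
split=> [n|m n p g f]; apply: BoxLin_map_inj => x; first exact: pullback_id.
exact: pullback_comp (svalP f).
Qed.

Lemma pullback_BoxLin_bij (m n : nat) : bijective (@pullback_BoxLin m n).
Proof.
pose inv (g : mor BoxLin m n) : mor Gamma m n :=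
  exist _ (ptd_of_cube (BoxLin_map g) : mor (maps_category fin_ptd) n m) erefl.
exists inv => [f|g].
  by apply: Gamma_map_inj; exact: ptd_of_cube_pullback (svalP f).
apply: BoxLin_map_inj; have [L gL] := svalP g.
exact: pullback_ptd_of_cube gL.
Qed.

Theorem mainTheorem4 :
  exists (F1 : forall m n : nat, mor Gamma m n -> mor BoxLin m n)
         (F1P : @is_functor Gamma BoxLin (fun n : nat => n) F1),
    (forall (m n : nat) (f : mor Gamma m n) (x : cube m),
        BoxLin_map (F1 m n f) x = pullback (Gamma_map f) x) /\
    is_equivalence (Functor F1P).
Proof.
exists pullback_BoxLin, pullback_is_functor; split=> //.
apply: fully_faithful_eso_equivalence; first exact: pullback_BoxLin_bij.
by move=> n; exists n, (idm _), (idm _); rewrite !comp_idl.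
Qed.
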